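(* Let $k, l, \Delta, n$ be integers with $1<k\leq l<\Delta<n$, and let $G$ be a connected $\{B_{k+1},K_{2,l+1}\}$-free graph of order $n$ with maximum degree $\Delta$. Then $$q(G)\leq \frac{1}{4}\left[3\Delta+k-2l+1+\sqrt{(3\Delta+k-2l+1)^{2}+16l(\Delta+n-1)}\right],$$ with equality if and only if $G$ is a strongly regular graph with parameters $(\Delta,k,l)$.
   Context: All graphs are finite and simple; the order of a graph is its number of vertices. For a graph $G$ with vertices $v_1,\dots,v_n$, let $A(G)$ be its adjacency matrix and $D(G)$ the diagonal matrix of its vertex degrees. The signless Laplacian matrix is $Q(G)=D(G)+A(G)$, and $q(G)$ denotes the largest eigenvalue of $Q(G)$. The book $B_m=K_2+\overline{K_m}$ (join) is the graph consisting of $m$ triangles sharing one common edge. $K_{s,t}$ is the complete bipartite graph with parts of sizes $s$ and $t$. A graph is $\{F_1,F_2\}$-free if it contains neither $F_1$ nor $F_2$ as a (not necessarily induced) subgraph. A graph is strongly regular with parameters $(d,a,c)$ if it is $d$-regular, each pair of adjacent vertices has exactly $a\geq 0$ common neighbors, and each pair of distinct non-adjacent vertices has exactly $c\geq 1$ common neighbors. *)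

(* Defs.v *)
From HB Require Import structures.
From mathcomp Require Import all_boot all_order all_algebra.
From mathcomp Require Import complex polyrcf.

Set Implicit Arguments.
Unset Strict Implicit.
Unset Printing Implicit Defensive.

Import Order.TTheory GRing.Theory Num.Theory.
Local Open Scope ring_scope.

Section Graphs.
Variable T : finType.
Implicit Types (e : rel T) (x y : T).

Definition simple_graph e := symmetric e /\ irreflexive e.

Definition deg e x : nat := #|[set y | e x y]|.

Definition max_deg e : nat := (\max_(x : T) deg e x)%N.

Definition common_nbrs e x y : nat := #|[set z | e x z && e y z]|.

Definition connected_graph e := forall x y, connect e x y.

Definition strongly_regular e (d a c : nat) :=
  [/\ (1 <= c)%N,
      forall x, deg e x = d,
      forall x y, e x y -> common_nbrs e x y = a
    & forall x y, x != y -> ~~ e x y -> common_nbrs e x y = c].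

Definition graph_compl e : rel T := fun x y => (x != y) && ~~ e x y.
End Graphs.

Definition complete_graph (m : nat) : rel 'I_m := fun x y => x != y.

Definition graph_join (S T : finType) (eS : rel S) (eT : rel T) :
    rel (S + T)%type := fun u v =>
  match u, v with
  | inl x, inl y => eS x y
  | inr x, inr y => eT x y
  | _, _ => true
  end.

Definition book (m : nat) : rel ('I_2 + 'I_m)%type :=
  graph_join (@complete_graph 2) (graph_compl (@complete_graph m)).

Definition complete_bipartite (s t : nat) : rel ('I_s + 'I_t)%type :=
  fun u v => match u, v with
  | inl _, inr _ | inr _, inl _ => true
  | _, _ => false
  end.

Arguments complete_graph : clear implicits.
Arguments book : clear implicits.
Arguments complete_bipartite : clear implicits.

(* Not necessarily induced: only edges have to be preserved. *)
Definition has_subgraph (S T : finType) (f : rel S) (e : rel T) :=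
  exists h : S -> T, injective h /\ forall x y, f x y -> e (h x) (h y).

Section Spectrum.
Variables (R : rcfType) (n : nat).
Implicit Types (e : rel 'I_n) (A : 'M[R]_n).

Definition adjacency_mx e : 'M[R]_n := \matrix_(i, j) (e i j)%:R.

Definition degree_mx e : 'M[R]_n := diag_mx (\row_i (deg e i)%:R).

Definition signless_laplacian e : 'M[R]_n := degree_mx e + adjacency_mx e.

Definition is_largest_eigenvalue A (q : R) :=
  eigenvalue A q /\ forall a, eigenvalue A a -> a <= q.

Lemma symmetric_eigenvalue A :
  (0 < n)%N -> A^T = A -> exists a, eigenvalue A a.
Proof.
move=> n_gt0 symA; pose toC := real_complex R.
have [z ez] := eigenvalue_closed (map_mx toC A) n_gt0.
have /eigenvalueP[v vA v_neq0] := ez.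
pose w := map_mx Num.conj v^T.
have conjA : map_mx Num.conj (map_mx toC A) = map_mx toC A.
  apply/matrixP => i j; rewrite !mxE.
  by apply/eqP; rewrite eq_complex /= oppr0 !eqxx.
have wA : map_mx toC A *m w = z^* *: w.
  have := congr1 (fun B => map_mx Num.conj B^T) vA.
  by rewrite trmx_mul map_mxM map_trmx symA conjA linearZ /= map_mxZ.
have vw_neq0 : (v *m w) 0 0 != 0.
  have [j vj] : exists j, v 0 j != 0 by apply/rV0Pn.
  rewrite mxE psumr_neq0 => [|i _]; last by rewrite !mxE mul_conjC_ge0.
  apply/hasP; exists j; first by rewrite mem_index_enum.
  by rewrite !mxE mul_conjC_gt0.
have zR : z^* = z.
  have : (v *m map_mx toC A) *m w = v *m (map_mx toC A *m w) by rewrite mulmxA.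
  rewrite vA wA -scalemxAl -scalemxAr => /matrixP/(_ 0 0).
  by rewrite mxE [RHS]mxE => /(mulIf vw_neq0).
have zE : z = toC (complex.Re z).
  by case: (z) zR => a b [] /eqP; rewrite eqNr => /eqP->.
exists (complex.Re z); rewrite eigenvalue_root_char.
by move: ez; rewrite zE eigenvalue_root_char -map_char_poly fmorph_root.
Qed.

Lemma symmetric_largest_eigenvalue A :
  (0 < n)%N -> A^T = A -> exists q, is_largest_eigenvalue A q.
Proof.
move=> n_gt0 symA; have [a eA] := symmetric_eigenvalue n_gt0 symA.
pose s := rootsR (char_poly A).
have p_neq0 : char_poly A != 0 by rewrite monic_neq0 ?char_poly_monic.
have sE b : eigenvalue A b = (b \in s).
  by rewrite eigenvalue_root_char -(roots_on_rootsR p_neq0) in_itv.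
have [q qs qmax] : exists2 q, q \in s & forall b, b \in s -> b <= q.
  have: a \in s by rewrite -sE.
  elim: (s) a {eA} => //= x t IHt a _.
  case: t IHt => [_|y t IHt].
    by exists x => [|b]; rewrite inE // => /eqP->.
  have [q qt qmax] := IHt y (mem_head _ _).
  exists (Num.max x q) => [|b].
    by rewrite inE; case: leP; rewrite ?qt ?orbT ?eqxx.
  by rewrite inE le_max => /predU1P[->|/qmax->]; rewrite ?lexx ?orbT.
by exists q; split=> [|b]; rewrite sE // => /qmax.
Qed.

Lemma signless_laplacian_largest_eigenvalue e :
  (0 < n)%N -> simple_graph e ->
  exists q, is_largest_eigenvalue (signless_laplacian e) q.
Proof.
move=> n_gt0 [e_sym _]; apply: symmetric_largest_eigenvalue => //.
rewrite linearD /= tr_diag_mx; congr (_ + _).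
by apply/matrixP => i j; rewrite !mxE e_sym.
Qed.
End Spectrum.

(* Main.v *)
Require Import Defs.
From mathcomp Require Import all_boot all_order all_algebra.
From mathcomp Require Import ring lra zify.
Import Order.TTheory GRing.Theory Num.Theory.
Local Open Scope ring_scope.

(** Why the theorem holds. Excluding [book k.+1] and [K_(2, l.+1)] says that
    two vertices have at most [k] common neighbours when they are adjacent and
    at most [l] when they are distinct, so counting the walks of length two
    that start at [i] gives
      [\sum_(j ~ i) d_j <= d_i + k d_i + l (n - 1 - d_i)],
    with equality exactly when every count of common neighbours is extremal
    ([leqif_sum_deg_nbrs]). The all-ones vector satisfies [1 Q = 2 d], so with
    [d_i^2 <= Delta d_i] this gives [1 Q^2 <= c (1 Q) + m 1], where [c = Delta + k + 1 - l] and
    [m = 2 l (n - 1)].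

    A linear inequality between powers of a nonnegative matrix applied to a
    positive vector passes to the eigenvalues, here in the form
    [q^2 - c q - m <= 0]. In place of a Perron eigenvector the argument uses
    test vectors: for an irreducible nonnegative matrix with eigenvalue [q],
    a positive [w] with [w A <= q w] satisfies [w A = q w]
    ([subinvariant_invariant]). With [w = 1] this gives [q <= 2 Delta], with
    equality only for regular graphs; with [w = 1 Q + (q - c) 1] it gives the
    quadratic inequality. Finally
      [2 q^2 - (3 Delta + k - 2 l + 1) q - 2 l (Delta + n - 1)
         = (q^2 - c q - m) + (q - 2 Delta) (q + l)]
    is a sum of two nonpositive terms, and the bound of the theorem is the
    positive root of the left-hand side. Equality forces both terms to vanish:
    the graph is [Delta]-regular, the walk count is tight at every vertex, and
    so the graph is strongly regular. *)

(** * Common neighbours and walks of length two *)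

Section CommonNeighbours.
Variable T : finType.
Implicit Types (e : rel T) (x y : T).

(** Both forbidden graphs consist of two vertices joined to [m] others; this
    is the embedding that they share. *)
Lemma common_nbrs_embedding e x y m :
  irreflexive e -> x != y -> (m <= common_nbrs e x y)%N ->
  exists h : 'I_2 + 'I_m -> T,
    [/\ injective h, forall a, h (inl a) = if a == 0 then x else y
      & forall a b, e (h (inl a)) (h (inr b))].
Proof.
move=> irr xy le_m.
pose c (b : 'I_m) := enum_val (widen_ord le_m b).
have cP b : e x (c b) && e y (c b).
  by have := enum_valP (widen_ord le_m b); rewrite inE.
pose p (a : 'I_2) := if a == 0 then x else y.
have pc a b : e (p a) (c b) by rewrite /p; case: ifP; case/andP: (cP b).
have neq a b : p a <> c b by move=> E; have := pc a b; rewrite E irr.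
exists (fun u => match u with inl a => p a | inr b => c b end); split=> //.
case=> a [] b; rewrite /p => E.
- congr inl; move: E.
  case: a b => [[|[|a]] ha] [[|[|b]] hb] //= E; try exact: val_inj;
    by move: xy; rewrite E eqxx.
- by case: (neq a b).
- by case: (neq b a).
- by have /(congr1 val)/= /val_inj-> := enum_val_inj E.
Qed.

Lemma book_free_common_nbrs e x y k :
  simple_graph e -> ~ has_subgraph (book k.+1) e -> e x y ->
  (common_nbrs e x y <= k)%N.
Proof.
move=> [sym irr] hB exy; rewrite leqNgt; apply/negP => lt_k.
have xy : x != y by apply: contraTneq exy => ->; rewrite irr.
have [h [h_inj hl hr]] := common_nbrs_embedding _ _ _ _ irr xy lt_k.
apply: hB; exists h; split=> // -[a|a] [b|b] //=.
- rewrite !hl /complete_graph.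
  by case: a b => [[|[|a]] ha] [[|[|b]] hb] //= _; rewrite sym.
- by rewrite sym.
- by rewrite /graph_compl /complete_graph negbK andNb.
Qed.

Lemma K2_free_common_nbrs e x y l :
  simple_graph e -> ~ has_subgraph (complete_bipartite 2 l.+1) e -> x != y ->
  (common_nbrs e x y <= l)%N.
Proof.
move=> [sym irr] hK xy; rewrite leqNgt; apply/negP => lt_l.
have [h [h_inj hl hr]] := common_nbrs_embedding _ _ _ _ irr xy lt_l.
by apply: hK; exists h; split=> // -[a|a] [b|b] //= _; rewrite sym.
Qed.

(** Both sides count the walks of length two from [x], according to their
    middle vertex and according to their last vertex. *)
Lemma sum_deg_nbrs e x : symmetric e ->
  (\sum_(y | e x y) deg e y = \sum_y common_nbrs e x y)%N.
Proof.
move=> sym; under [RHS]eq_bigr do rewrite /common_nbrs -sum1_card.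
under [LHS]eq_bigr do rewrite /deg -sum1_card.
rewrite (exchange_big_dep predT) //=.
apply: eq_bigr => y _; apply: eq_bigl => z.
by rewrite !inE [e z y]sym.
Qed.

(** Among the walks of length two from [x], those that return to [x] number
    [deg e x]; the term at each other end vertex [y] is bounded separately, so
    equality of the sums is equality term by term. *)
Lemma leqif_sum_deg_nbrs e x k l :
  simple_graph e ->
  (forall y, e x y -> common_nbrs e x y <= k)%N ->
  (forall y, x != y -> common_nbrs e x y <= l)%N ->
  (\sum_(y | e x y) deg e y <=
     deg e x + (k * deg e x + l * (#|T|.-1 - deg e x))
     ?= iff [forall (y | y != x), common_nbrs e x y == if e x y then k else l])%N.
Proof.
move=> [sym irr] hk hl.
have -> : (k * deg e x + l * (#|T|.-1 - deg e x) =
           \sum_(y | y != x) if e x y then k else l)%N.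
  (* Since [e] is irreflexive, the vertices other than [x] are its
     [deg e x] neighbours and the [#|T|.-1 - deg e x] others. *)
  transitivity (\sum_(y | (y != x) && e x y) k +
                \sum_(y | (y != x) && ~~ e x y) l)%N; last first.
    rewrite [RHS](bigID (e x)) /=; congr (_ + _)%N; apply: eq_bigr => y.
      by case/andP=> _ ->.
    by case/andP=> _ /negbTE->.
  rewrite !sum_nat_const mulnC [(l * _)%N]mulnC.
  have dE : #|[pred y | (y != x) && e x y]| = deg e x.
    by apply: eq_card => y; rewrite !inE; case: eqP => //= ->; rewrite irr.
  have : (#|[pred y | (y != x) && e x y]| +
          #|[pred y | (y != x) && ~~ e x y]| = #|T|.-1)%N.
    rewrite -(cardC1 x) -(cardID (e x) (predC1 x)).
    by congr (_ + _)%N; apply: eq_card => y; rewrite !inE // andbC.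
  by rewrite dE => <-; rewrite addKn.
rewrite (sum_deg_nbrs _ _ sym) (bigD1 x) //=.
have -> : common_nbrs e x x = deg e x.
  by apply: eq_card => y; rewrite !inE andbb.
rewrite /leqif leq_add2l eqn_add2l; apply: leqif_sum => y yx.
by split=> //; case: ifP => [/hk//|_]; apply: hl; rewrite eq_sym.
Qed.

End CommonNeighbours.

(** * Test vectors for an irreducible nonnegative matrix *)

Section Subinvariance.
Variables (R : rcfType) (n : nat) (A : 'M[R]_n) (q : R) (w : 'rV[R]_n).
Hypothesis A_ge0 : forall i j, 0 <= A i j.
Hypothesis A_irr : forall i j, connect [rel a b | 0 < A b a] i j.
Hypothesis w_gt0 : forall i, 0 < w 0 i.
Hypothesis qA : eigenvalue A q.

(** Let [v] be an eigenvector and let [i] maximise [|v_i| / w_i], with maximum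
    [M]. The triangle inequality at [i] and the hypothesis squeeze each other:
    [|q| M w_i <= (|v| A)_i <= M (w A)_i <= M q w_i]. So equality holds at [i],
    and every [j] with [A j i > 0] is again a maximiser; irreducibility spreads
    this to all indices. *)
Lemma subinvariant_invariant :
  (forall i, (w *m A) 0 i <= q * w 0 i) ->
  forall i, (w *m A) 0 i = q * w 0 i.
Proof.
move=> sub; have /eigenvalueP[v vA /rV0Pn[i0 vi0]] := qA.
pose F i := `|v 0 i| / w 0 i.
have [m _ mP] := Order.TotalTheory.arg_maxP F (erefl (xpredT i0)).
pose M := F m.
have M_gt0 : 0 < M.
  by apply: lt_le_trans (mP i0 erefl); rewrite divr_gt0 ?normr_gt0.
have leM j : `|v 0 j| <= M * w 0 j by rewrite -ler_pdivrMr //; apply: mP.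
have key i : `|v 0 i| = M * w 0 i ->
    (w *m A) 0 i = q * w 0 i /\
    forall j, 0 < A j i -> `|v 0 j| = M * w 0 j.
  move=> vi.
  have vAi : q * v 0 i = \sum_j v 0 j * A j i.
    by have /matrixP/(_ 0 i) := vA; rewrite !mxE.
  have lo : q * (M * w 0 i) <= \sum_j `|v 0 j| * A j i.
    rewrite -vi; apply: le_trans (_ : `|q * v 0 i| <= _).
      by rewrite normrM ler_wpM2r // ler_norm.
    rewrite vAi; apply: le_trans (ler_norm_sum _ _ _) _.
    by apply: ler_sum => j _; rewrite normrM (ger0_norm (A_ge0 j i)).
  have hi : M * (w *m A) 0 i <= q * (M * w 0 i).
    by rewrite mulrCA ler_wpM2l // ltW.
  have dE : M * (w *m A) 0 i - \sum_j `|v 0 j| * A j i =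
      \sum_j (M * w 0 j - `|v 0 j|) * A j i.
    rewrite mxE mulr_sumr -sumrB; apply: eq_bigr => j _.
    by rewrite mulrBl mulrA.
  have d_ge0 j : true -> 0 <= (M * w 0 j - `|v 0 j|) * A j i.
    by move=> _; rewrite mulr_ge0 // subr_ge0.
  have s_ge0 := sumr_ge0 _ d_ge0.
  have s0 : \sum_j (M * w 0 j - `|v 0 j|) * A j i = 0.
    by apply/eqP; rewrite eq_le s_ge0 andbT -dE subr_le0 (le_trans hi).
  split.
    apply: (mulfI (lt0r_neq0 M_gt0)); apply/eqP.
    rewrite eq_le mulrCA hi /=; apply: le_trans lo _.
    by rewrite -subr_ge0 dE.
  move=> j Aji; have /eqP := @psumr_eq0P _ _ _ _ d_ge0 s0 j erefl.
  by rewrite mulf_eq0 (gt_eqF Aji) orbF subr_eq0 => /eqP.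
have all_max j : `|v 0 j| = M * w 0 j.
  have /connectP[p] := A_irr m j.
  have : `|v 0 m| = M * w 0 m by rewrite /M /F divfK // gt_eqF.
  elim: p (m) => [|b p IHp] a va /=; first by move=> _ ->.
  by case/andP=> /= Aba; apply: IHp; case: (key a va) => _; apply.
by move=> i; case: (key i (all_max i)).
Qed.

End Subinvariance.

(** * The spectrum of the signless Laplacian *)

Section SignlessLaplacian.
Variables (R : rcfType) (n : nat) (e : rel 'I_n).
Hypothesis simple_e : simple_graph e.
Hypothesis conn_e : connected_graph e.
Notation Q := (signless_laplacian R e).
Notation d i := ((deg e i)%:R : R).

Lemma mul_signless_laplacian (w : 'rV[R]_n) i :
  (w *m Q) 0 i = d i * w 0 i + \sum_(j | e i j) w 0 j.
Proof.
have [sym _] := simple_e.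
rewrite /signless_laplacian mulmxDr mxE mul_mx_diag !mxE mulrC.
congr (_ + _); rewrite [RHS]big_mkcond /=.
by apply: eq_bigr => j _; rewrite mxE sym; case: (e i j); rewrite ?mulr1 ?mulr0.
Qed.

Lemma mul_ones_signless_laplacian i :
  ((const_mx 1 : 'rV[R]_n) *m Q) 0 i = 2 * d i.
Proof.
rewrite mul_signless_laplacian mxE mulr1.
under eq_bigr do rewrite mxE.
rewrite sumr_const; have -> : #|e i| = deg e i.
  by apply: eq_card => j; rewrite !inE.
by rewrite mulr_natl mulr2n.
Qed.

Lemma signless_laplacian_invariant q (w : 'rV[R]_n) :
  eigenvalue Q q -> (forall i, 0 < w 0 i) ->
  (forall i, (w *m Q) 0 i <= q * w 0 i) ->
  forall i, (w *m Q) 0 i = q * w 0 i.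
Proof.
have [sym irr] := simple_e.
have QE i j : Q i j = d i *+ (i == j) + (e i j)%:R.
  by rewrite !mxE; case: eqP => [->|].
move=> qQ w_gt0; apply: subinvariant_invariant => // i j.
  by rewrite QE addr_ge0 // mulrn_wge0.
apply: connect_sub (conn_e i j) => a b eab; apply: connect1 => /=.
by rewrite QE sym eab ltr_wpDl // mulrn_wge0.
Qed.

Variable D : nat.
Hypothesis deg_le : forall i, (deg e i <= D)%N.

Lemma eigenvalue_le_2D q (i0 : 'I_n) : eigenvalue Q q -> q <= 2 * D%:R.
Proof.
move=> qQ; rewrite leNgt; apply/negP => ltq.
have lt i : ((const_mx 1 : 'rV[R]_n) *m Q) 0 i <
            q * (const_mx 1 : 'rV[R]_n) 0 i.
  rewrite mul_ones_signless_laplacian mxE mulr1; apply: le_lt_trans ltq.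
  by rewrite ler_pM2l // ler_nat.
have := signless_laplacian_invariant q (const_mx 1) qQ.
move=> /(_ _ _ i0) E; have := lt i0; rewrite E ?ltxx // => i.
  by rewrite mxE.
exact: ltW.
Qed.

Lemma eigenvalue_2D_regular :
  eigenvalue Q (2 * D%:R) -> forall i, deg e i = D.
Proof.
move=> qQ i.
have := signless_laplacian_invariant _ (const_mx 1) qQ.
move=> /(_ _ _ i); rewrite mul_ones_signless_laplacian mxE mulr1 => E.
apply/eqP; rewrite -(eqr_nat R); apply/eqP.
apply: (mulfI (_ : 2 != 0 :> R)); first by rewrite pnatr_eq0.
apply: E => j; first by rewrite mxE.
by rewrite mul_ones_signless_laplacian mxE mulr1 ler_pM2l // ler_nat.
Qed.

Lemma regular_eigenvalue_2D (i0 : 'I_n) :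
  (forall i, deg e i = D) -> eigenvalue Q (2 * D%:R).
Proof.
move=> reg; apply/eigenvalueP; exists (const_mx 1).
  apply/rowP => i; rewrite mul_ones_signless_laplacian !mxE reg.
  by rewrite mulr1.
by apply/rV0Pn; exists i0; rewrite mxE oner_neq0.
Qed.

(** The last hypothesis is [1 Q^2 <= c (1 Q) + m 1], written out entrywise. If
    [q^2 - c q - m] were positive, then [q > c] and the test vector
    [w = 1 Q + (q - c) 1] would satisfy
    [w Q <= q (1 Q) + m 1 < q (1 Q) + q (q - c) 1 = q w]. *)
Lemma quadratic_eigenvalue_le (c m q : R) (i0 : 'I_n) :
  0 <= m -> 0 < q -> eigenvalue Q q ->
  (forall i, 2 * (d i ^+ 2 + \sum_(j | e i j) d j) <= c * (2 * d i) + m) ->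
  q ^+ 2 - c * q - m <= 0.
Proof.
move=> m_ge0 q_gt0 qQ two; rewrite leNgt; apply/negP => gt0.
have qc : 0 < q - c.
  have : 0 < q * (q - c) by rewrite expr2 in gt0; lra.
  by rewrite pmulr_rgt0.
pose w : 'rV[R]_n := \row_i (2 * d i + (q - c)).
have w_gt0 i : 0 < w 0 i by rewrite mxE ltr_wpDl // mulr_ge0.
have lt i : (w *m Q) 0 i < q * w 0 i.
  rewrite mul_signless_laplacian.
  under eq_bigr do rewrite mxE.
  rewrite big_split /= -mulr_sumr sumr_const.
  have -> : #|e i| = deg e i by apply: eq_card => j; rewrite !inE.
  have := two i; rewrite mxE -mulr_natr; set s := \sum_(j | _) _.
  rewrite !expr2 in gt0 *; lra.
have E := signless_laplacian_invariant q w qQ w_gt0 (fun i => ltW (lt i)) i0.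
by have := lt i0; rewrite E ltxx.
Qed.

End SignlessLaplacian.

(** * The bound as a root of a quadratic *)

(** The roots have product [- p / 2 < 0], so the second one is some [- z] with
    [z > 0], and for positive [q] the quadratic has the sign of [q - y]. *)
Lemma quadratic_positive_root (R : rcfType) (b p : R) : 0 < p ->
  let y := 4^-1 * (b + Num.sqrt (b ^+ 2 + 8 * p)) in
  0 < y /\ exists2 z, 0 < z &
    forall q, 2 * q ^+ 2 - b * q - p = 2 * (q - y) * (q + z).
Proof.
move=> p_gt0; set s := Num.sqrt _ => y.
have s2 : s ^+ 2 = b ^+ 2 + 8 * p.
  by rewrite sqr_sqrtr // addr_ge0 ?sqr_ge0 // mulr_ge0 // ltW.
have /ltr_normlP[b1 b2] : `|b| < s.
  by rewrite -sqrtr_sqr ltr_sqrt; have := sqr_ge0 b; lra.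
split; first by rewrite /y; lra.
exists (4^-1 * (s - b)); first by lra.
move=> q; have -> : p = 8^-1 * (s ^+ 2 - b ^+ 2) by rewrite s2; field.
by rewrite /y; field.
Qed.

Theorem theorem1p4 (R : rcfType) (k l Delta n : nat) (e : rel 'I_n) (q : R)
    (hk : (1 < k)%N) (hkl : (k <= l)%N) (hlD : (l < Delta)%N)
    (hDn : (Delta < n)%N)
    (he : simple_graph e)
    (hconn : connected_graph e)
    (hbook : ~ has_subgraph (book k.+1) e)
    (hK2 : ~ has_subgraph (complete_bipartite 2 l.+1) e)
    (hmax : max_deg e = Delta)
    (hq : is_largest_eigenvalue (signless_laplacian R e) q) :
  let b : R := 3 * Delta%:R + k%:R - 2 * l%:R + 1 in
  let bound : R :=
    4^-1 * (b + Num.sqrt (b ^+ 2 + 16 * l%:R * (Delta%:R + n%:R - 1))) in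
  q <= bound /\ (q = bound <-> strongly_regular e Delta k l).
Proof.
move=> b bound; have [qQ q_max] := hq.
pose i0 : 'I_n := Ordinal hDn.
have deg_le i : (deg e i <= Delta)%N by rewrite -hmax; apply: leq_bigmax.
have l_gt0 : 0 < l%:R :> R by rewrite ltr0n; lia.
have D_gt0 : 0 < Delta%:R :> R by rewrite ltr0n; lia.
have n_gt1 : 1 < n%:R :> R by rewrite ltr1n; lia.
pose p : R := 2 * l%:R * (Delta%:R + n%:R - 1).
have p_gt0 : 0 < p by rewrite /p !mulr_gt0 //; lra.
have [] := quadratic_positive_root R b p p_gt0; rewrite /=.
have -> : 8 * p = 16 * l%:R * (Delta%:R + n%:R - 1) by rewrite /p; ring.
rewrite -/bound => bound_gt0 [z z_gt0 boundE].
have walks i := leqif_sum_deg_nbrs _ e i k l he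
  (fun y => book_free_common_nbrs _ e i y k he hbook)
  (fun y => K2_free_common_nbrs _ e i y l he hK2).
have walkbound i : ((deg e i + (k * deg e i + l * (#|'I_n|.-1 - deg e i)))%N%:R
    = (k%:R + 1 - l%:R) * (deg e i)%:R + l%:R * (n%:R - 1) :> R).
  have ? := deg_le i.
  rewrite card_ord !natrD !natrM natrB; last by lia.
  by rewrite -subn1 natrB; [ring | lia].
pose c : R := Delta%:R + k%:R + 1 - l%:R.
pose m : R := 2 * l%:R * (n%:R - 1).
have splitE t : 2 * t ^+ 2 - b * t - p =
    (t ^+ 2 - c * t - m) + (t - 2 * Delta%:R) * (t + l%:R).
  by rewrite /b /p /c /m; ring.
have q_le : q <= 2 * Delta%:R.
  exact: (eigenvalue_le_2D R n e he hconn Delta deg_le q i0).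
have quad : 0 < q -> q ^+ 2 - c * q - m <= 0.
  move=> q_gt0; apply: (quadratic_eigenvalue_le R n e) => //.
    by rewrite /m mulr_ge0 ?mulr_ge0 //; lra.
  move=> i; have [+ _] := walks i; rewrite -(ler_nat R) walkbound natr_sum => le1.
  have : (deg e i)%:R ^+ 2 <= Delta%:R * (deg e i)%:R :> R.
    by rewrite expr2 ler_wpM2r // ler_nat.
  by rewrite /c /m; lra.
have prod_le : 0 < q -> (q - 2 * Delta%:R) * (q + l%:R) <= 0.
  by move=> q_gt0; rewrite mulr_le0_ge0 ?subr_le0 // addr_ge0 ?ltW.
split; [|split].
- have [q_le0|q_gt0] := lerP q 0; first exact: le_trans q_le0 (ltW bound_gt0).
  have : 2 * (q - bound) * (q + z) <= 0.
    by rewrite -boundE splitE; have := quad q_gt0; have := prod_le q_gt0; lra.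
  by rewrite pmulr_lle0 ?addr_gt0 // pmulr_rle0 // subr_le0.
- move=> qE; have q_gt0 : 0 < q by rewrite qE.
  have := boundE q; rewrite qE subrr mulr0 mul0r -qE splitE => sum0.
  have f1 : q ^+ 2 - c * q - m = 0.
    by have := quad q_gt0; have := prod_le q_gt0; lra.
  have : (q - 2 * Delta%:R) * (q + l%:R) = 0 by lra.
  move/eqP; rewrite mulf_eq0 (gt_eqF (addr_gt0 q_gt0 l_gt0)) orbF subr_eq0.
  move/eqP=> q2D; rewrite q2D in qQ f1.
  have reg := eigenvalue_2D_regular R n e he hconn Delta deg_le qQ.
  have tight x y : x != y -> common_nbrs e x y = if e x y then k else l.
    move=> xy; have [_ +] := walks x.
    have -> : (\sum_(j | e x j) deg e j)%N =
        (deg e x + (k * deg e x + l * (#|'I_n|.-1 - deg e x)))%N.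
      apply/eqP; rewrite -(eqr_nat R) walkbound.
      under eq_bigr do rewrite reg.
      rewrite sum_nat_const; have -> : #|e x| = Delta.
        by rewrite -(reg x); apply: eq_card => j; rewrite !inE.
      by rewrite reg natrM; apply/eqP; rewrite /c /m expr2 in f1; lra.
    rewrite eqxx => /esym/forall_inP/(_ y).
    by rewrite eq_sym => /(_ xy)/eqP.
  have [_ irr] := he.
  split=> // [|x y exy|x y xy /negbTE exy]; first by lia.
    by rewrite tight ?exy //; apply: contraTneq exy => ->; rewrite irr.
  by rewrite tight // exy.
- case=> _ reg adj nadj.
  have q2D : q = 2 * Delta%:R.
    apply/eqP; rewrite eq_le q_le; apply: q_max.
    exact: (regular_eigenvalue_2D R n e he Delta i0 reg).
  have tight : ((\sum_(j | e i0 j) deg e j)%N =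
        (deg e i0 + (k * deg e i0 + l * (#|'I_n|.-1 - deg e i0)))%N).
    apply/eqP; have [_ ->] := walks i0; apply/forall_inP => y yi0.
    by case: ifP => [/adj->//|/negbT/nadj->//]; rewrite eq_sym.
  have f1 : q ^+ 2 - c * q - m = 0.
    have := congr1 (fun a => a%:R : R) tight; rewrite /= walkbound.
    under eq_bigr do rewrite reg.
    rewrite sum_nat_const; have -> : #|e i0| = Delta.
      by rewrite -(reg i0); apply: eq_card => j; rewrite !inE.
    by rewrite reg natrM q2D /c /m expr2; lra.
  have := boundE q; rewrite splitE f1 q2D subrr mul0r addr0 -q2D => /esym/eqP.
  have q_gt0 : 0 < q by rewrite q2D mulr_gt0.
  rewrite !mulf_eq0 pnatr_eq0 (gt_eqF (addr_gt0 q_gt0 z_gt0)) orbF /=.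
  by rewrite subr_eq0 => /eqP.
Qed.
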